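(* Let $(M,g)$ be a Lorentzian manifold of dimension $n\ge3$, $c$ a null congruence on $M$, and $W$ a symmetric double 2-form on $M$, i.e. a rank 4 tensor field with $W_{abcd}=W_{[ab][cd]}=W_{cdab}$, of type III with boost order $-1$ along $c$, i.e. $\mathrm{bo}_c(W)=-1$ (at every point). If $\mathrm{bo}_c(\nabla W)\le 0$, then $c$ is geodetic. If moreover $\mathrm{bo}_c(\nabla\nabla W)\le0$, then $c$ is Kundt.
   Context: Lorentzian metrics have signature $(-,+,\dots,+)$ and $\nabla$ is the Levi-Civita connection. A null congruence $c$ (equivalently null line distribution) is a smooth rank-one subbundle of $TM$ whose fibres are null lines. With $k$ a local non-vanishing section of $c$: $c$ is geodetic if $k^a\nabla_ak^b\propto k^b$; $c$ is Kundt (non-twisting, hence geodetic, non-shearing and non-expanding) if $X^a\nabla_ak^b\propto k^b$ for all $X\in c^\perp$, equivalently $k_{[a}\nabla_{b]}k_{[c}k_{d]}=0$. Boost order: at each point take a null frame $\{e_0,e_1,e_i\}=\{k,l,m_i\}$ ($2\le i\le n-1$) with $0\ne k\in c$, whose only non-zero inner products are $g(k,l)=g(m_i,m_i)=1$. The boost weight of a multi-index $\alpha_1\cdots\alpha_r$ is (number of $0$'s) minus (number of $1$'s). The boost order $\mathrm{bo}_c(T)$ of a non-zero covariant tensor $T$ is the largest boost weight of a multi-index with $T_{\alpha_1\cdots\alpha_r}=T(e_{\alpha_1},\dots,e_{\alpha_r})\ne0$ (independent of the frame); the zero tensor is regarded as having boost order $\le s$ for every $s$. Conditions on boost orders of tensor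 fields are meant at every point. For symmetric double 2-forms, type III means having boost order $-1$ along the (unique) null congruence along which the boost order is negative. *)

(* Defs.v *)
From mathcomp Require Import all_boot all_order all_algebra.
From mathcomp Require Import all_classical all_reals.
From mathcomp Require Import topology normedtype derive.
From mathcomp Require Import ring.

Set Implicit Arguments.
Unset Strict Implicit.
Unset Printing Implicit Defensive.
Import Order.TTheory GRing.Theory Num.Theory.
Import numFieldNormedType.Exports.
Local Open Scope classical_set_scope.
Local Open Scope ring_scope.

Section SmoothFunctions.
Variables (R : realType) (n : nat).

Definition partial (i : 'I_n) (f : 'rV[R]_n -> R) : 'rV[R]_n -> R :=
  fun x => 'D_(delta_mx 0 i) f x.

(* For open U this only depends on f restricted to U. *)
Fixpoint Ck (k : nat) (U : set 'rV[R]_n) (f : 'rV[R]_n -> R) : Prop :=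
  (forall x, U x -> {for x, continuous f}) /\
  if k is k'.+1 then
    forall i : 'I_n, (forall x, U x -> derivable f x (delta_mx 0 i)) /\
                     Ck k' U (partial i f)
  else True.

Definition smooth_on (U : set 'rV[R]_n) (f : 'rV[R]_n -> R) : Prop :=
  forall k, Ck k U f.

Definition smooth_on_rV m (U : set 'rV[R]_n) (f : 'rV[R]_n -> 'rV[R]_m) : Prop :=
  forall j : 'I_m, smooth_on U (fun x => f x 0 j).

End SmoothFunctions.

(* A Hausdorff second countable space with a smooth atlas (not required to be
   maximal). [cmap a] and [cinv a] are total functions, meaningful only on
   [cdom a] and on its image respectively. *)
Record manifold (R : realType) (n : nat) := Manifold {
  points :> topologicalType ;
  chart : Type ;
  cdom : chart -> set points ;
  cmap : chart -> points -> 'rV[R]_n ;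
  cinv : chart -> 'rV[R]_n -> points ;
  points_hausdorff : hausdorff_space points ;
  points_second_countable : @second_countable points ;
  cdom_open : forall a, open (cdom a) ;
  cdom_cover : forall p, exists a, cdom a p ;
  cimg_open : forall a, open (cmap a @` cdom a) ;
  cmapK : forall a p, cdom a p -> cinv a (cmap a p) = p ;
  cmap_continuous : forall a p, cdom a p -> {for p, continuous (cmap a)} ;
  cinv_continuous : forall a x, (cmap a @` cdom a) x ->
    {for x, continuous (cinv a)} ;
  transition_smooth : forall a b,
    smooth_on_rV (cmap a @` (cdom a `&` cdom b)) (cmap b \o cinv a)
}.

Section Tensors.
Variables (R : realType) (n : nat) (M : manifold R n).

Definition cimg (a : chart M) : set 'rV[R]_n := cmap a @` cdom a.

Definition overlap (a b : chart M) : set 'rV[R]_n :=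
  cmap a @` (cdom a `&` cdom b).

Definition transition (a b : chart M) : 'rV[R]_n -> 'rV[R]_n :=
  cmap b \o cinv a.

(* A tangent vector at the point with coordinates x in the chart a is the row
   vector v of its components; on [overlap a b] its components in the chart b
   are [v *m 'J (transition a b) x]. *)

Definition multilinear_form r := r.-tuple 'I_n -> R.

Definition eval r (T : multilinear_form r) (v : 'I_r -> 'rV[R]_n) : R :=
  \sum_(beta : r.-tuple 'I_n) T beta * \prod_(s < r) v s 0 (tnth beta s).

(* Families of component functions of covariant rank r, one for each chart, as
   functions of the coordinates; meaningful on [cimg a] only. *)
Definition components r := chart M -> 'rV[R]_n -> multilinear_form r.

Record tensor_field r := TensorField {
  tcomp :> components r ;
  tcomp_smooth : forall a alpha, smooth_on (cimg a) (fun x => tcomp a x alpha) ;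
  tcomp_transition : forall a b x, overlap a b x ->
    forall alpha, tcomp a x alpha =
      eval (tcomp b (transition a b x))
           (fun s => row (tnth alpha s) ('J (transition a b) x))
}.

Definition bilin_mx (T : multilinear_form 2) : 'M[R]_n :=
  \matrix_(i, j) T [tuple i; j].

(* diag(-1, 1, ..., 1) *)
Definition minkowski_mx : 'M[R]_n :=
  \matrix_(i, j) (if i == j then if val i == 0%N then -1 else 1 else 0).

Record lorentz_metric := LorentzMetric {
  metric_tensor :> tensor_field 2 ;
  metric_signature : forall a x, cimg a x -> exists2 P : 'M[R]_n, P \in unitmx &
    P *m bilin_mx (tcomp metric_tensor a x) *m P^T = minkowski_mx
}.

Definition symmetric_double_2form (W : tensor_field 4) : Prop :=
  forall a x, cimg a x -> forall i j k l : 'I_n,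
    let w := tcomp W a x in
    [/\ w [tuple i; j; k; l] = - w [tuple j; i; k; l],
        w [tuple i; j; k; l] = - w [tuple i; j; l; k] &
        w [tuple i; j; k; l] = w [tuple k; l; i; j]].

End Tensors.

Section LeviCivita.
Variables (R : realType) (n : nat) (M : manifold R n) (g : lorentz_metric M).

Definition metric_mx (a : chart M) (x : 'rV[R]_n) : 'M[R]_n := bilin_mx (tcomp g a x).

Definition inner (a : chart M) (x u v : 'rV[R]_n) : R :=
  (u *m metric_mx a x *m v^T) 0 0.

(* [christoffel a x i j k] is Gamma^i_(j k). *)
Definition christoffel (a : chart M) (x : 'rV[R]_n) (i j k : 'I_n) : R :=
  2^-1 * \sum_(l < n) invmx (metric_mx a x) i l *
    (partial j (fun y => metric_mx a y l k) x
     + partial k (fun y => metric_mx a y l j) x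
     - partial l (fun y => metric_mx a y j k) x).

(* The index of the derivative comes first:
   [nabla T a x (e :: alpha)] is (nabla_e T)_alpha. *)
Definition nabla r (T : components M r) : components M r.+1 := fun a x t =>
  let e := thead t in
  let alpha : r.-tuple 'I_n := [tuple of behead t] in
  partial e (fun y => T a y alpha) x
  - \sum_(s < r) \sum_(f < n) christoffel a x f e (tnth alpha s) *
      T a x [tuple (if s' == s then f else tnth alpha s') | s' < r].

Definition nabla_vec (a : chart M) (x X : 'rV[R]_n) (k : 'rV[R]_n -> 'rV[R]_n) :
    'rV[R]_n :=
  \row_b \sum_(d < n) X 0 d *
    (partial d (fun y => k y 0 b) x
     + \sum_(e < n) christoffel a x b d e * k x 0 e).

End LeviCivita.

(* [christoffel] is torsion-free ([christoffel_sym]) and metric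
   ([nabla_metric]). *)
Section LeviCivitaTheory.
Variables (R : realType) (n : nat) (M : manifold R n) (g : lorentz_metric M).
Variables (a : chart M) (x : 'rV[R]_n) (ax : cimg a x).

Lemma metric_mx_sym y : cimg a y -> (metric_mx g a y)^T = metric_mx g a y.
Proof.
move=> /(metric_signature g)[P Pu]; rewrite -/(metric_mx g a y) => eP.
have PTu : P^T \in unitmx by rewrite unitmx_tr.
have -> : metric_mx g a y = invmx P *m minkowski_mx R n *m invmx P^T.
  by rewrite -eP !mulmxA mulVmx // mul1mx mulmxK.
rewrite !trmx_mul !trmx_inv trmxK mulmxA; congr (_ *m _ *m _).
by apply/matrixP => i j; rewrite !mxE [j == i]eq_sym; case: (eqVneq i j) => [->|].
Qed.

Lemma metric_mx_unit : metric_mx g a x \in unitmx.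
Proof.
have [P Pu] := metric_signature g ax; rewrite -/(metric_mx g a x) => eP.
have : minkowski_mx R n \in unitmx.
  have mink2 : minkowski_mx R n *m minkowski_mx R n = 1%:M.
    apply/matrixP => i j; rewrite !mxE (bigD1 i) //= big1 => [|k /negbTE ki].
      rewrite !mxE eqxx addr0; case: (eqVneq i j) => [->|_]; last by rewrite mulr0.
      by case: ifP; rewrite ?mulrNN mulr1.
    by rewrite !mxE eq_sym ki mul0r.
  by have [] := mulmx1_unit mink2.
by rewrite -eP !unitmx_mul => /andP[/andP[]].
Qed.

Lemma partial_metric_sym e i j :
  partial e (fun y => metric_mx g a y i j) x =
  partial e (fun y => metric_mx g a y j i) x.
Proof.
apply: near_eq_derive.
have : \forall y \near x, cimg a y by apply: open_nbhs_nbhs; split => //; exact: cimg_open.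
apply: filterS => y /metric_mx_sym ys; by rewrite -[in LHS]ys mxE.
Qed.

Lemma christoffel_sym i j k : christoffel g a x i j k = christoffel g a x i k j.
Proof.
congr (_ * _); apply: eq_bigr => l _.
by rewrite (partial_metric_sym l j k) [X in X - _]addrC.
Qed.

Let dG l j k := partial l (fun y => metric_mx g a y j k) x.

Lemma christoffel_lower e i j :
  \sum_(f < n) christoffel g a x f e i * metric_mx g a x f j =
  2^-1 * (dG e j i + dG i j e - dG j e i).
Proof.
under eq_bigr do rewrite -mulrA mulr_suml.
rewrite -mulr_sumr exchange_big /=; congr (_ * _).
have GV : (invmx (metric_mx g a x))^T *m metric_mx g a x = 1%:M.
  by rewrite trmx_inv metric_mx_sym // mulVmx // metric_mx_unit.
transitivity (\sum_l (1%:M : 'M[R]_n) l j * (dG e l i + dG i l e - dG l e i)).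
  apply: eq_bigr => l _; rewrite -GV mxE mulr_suml.
  by apply: eq_bigr => f _; rewrite mulrAC [_^T _ _]mxE.
rewrite (bigD1 j) //= mxE eqxx mul1r big1 ?addr0 // => l /negbTE lj.
by rewrite mxE lj mul0r.
Qed.

Lemma nabla_metric t : nabla g g a x t = 0.
Proof.
case/tupleP: t => e t; case/tupleP: t => i t; case/tupleP: t => j t.
rewrite (tuple0 t) /nabla theadE.
have -> : [tuple of behead [tuple of e :: [tuple of i :: [tuple of j :: [tuple]]]]]
   = [tuple i; j] by apply: val_inj.
rewrite big_ord_recl big_ord1.
have E y k l : tcomp g a y [tuple k; l] = metric_mx g a y k l by rewrite mxE.
set S1 := \sum_(f < n) _; set S2 := \sum_(f < n) _.
have -> : S1 = \sum_(f < n) christoffel g a x f e i * metric_mx g a x f j.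
  apply: eq_bigr => f _; rewrite -E; congr (_ * tcomp _ _ _ _).
  by apply: eq_from_tnth => s; rewrite tnth_mktuple; case: s => -[|[]].
have -> : S2 = \sum_(f < n) christoffel g a x f e j * metric_mx g a x f i.
  apply: eq_bigr => f _; rewrite -[in RHS](metric_mx_sym ax) mxE -E.
  congr (_ * tcomp _ _ _ _).
  by apply: eq_from_tnth => s; rewrite tnth_mktuple; case: s => -[|[]].
rewrite !christoffel_lower.
have -> : partial e (fun y => tcomp g a y [tuple i; j]) x = dG e i j.
  by congr (partial _ _ _); apply/funext => y; rewrite E.
rewrite /dG (partial_metric_sym e j i) (partial_metric_sym i j e).
rewrite (partial_metric_sym j i e) -mulrDr.
set u := partial e _ _; set v := partial i _ _; set w := partial j _ _.
by field.
Qed.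

End LeviCivitaTheory.

Record null_congruence (R : realType) (n : nat) (M : manifold R n)
    (g : lorentz_metric M) := NullCongruence {
  line :> chart M -> 'rV[R]_n -> set 'rV[R]_n ;
  line_transition : forall a b x, overlap a b x -> forall v : 'rV[R]_n,
    line a x v <-> line b (transition a b x) (v *m 'J (transition a b) x) ;
  line_smooth : forall a x, cimg a x ->
    exists (V : set 'rV[R]_n) (k : 'rV[R]_n -> 'rV[R]_n),
      [/\ open V, V x, V `<=` cimg a, smooth_on_rV V k &
          forall y, V y -> k y != 0 /\ line a y = [set t *: k y | t in [set: R]]] ;
  line_null : forall a x, cimg a x -> forall v, line a x v -> inner g a x v v = 0
}.

Section Congruences.
Variables (R : realType) (n : nat) (M : manifold R n) (g : lorentz_metric M).
Variable c : null_congruence g.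

Definition local_section (a : chart M) (V : set 'rV[R]_n)
    (k : 'rV[R]_n -> 'rV[R]_n) : Prop :=
  [/\ open V, V `<=` cimg a, smooth_on_rV V k &
      forall y, V y -> k y != 0 /\ c a y (k y)].

Definition geodetic : Prop :=
  forall a V k, local_section a V k -> forall x, V x ->
    exists mu : R, nabla_vec g a x (k x) k = mu *: k x.

Definition kundt : Prop :=
  forall a V k, local_section a V k -> forall x, V x ->
    forall X : 'rV[R]_n, inner g a x X (k x) = 0 ->
      exists mu : R, nabla_vec g a x X k = mu *: k x.

(* Gram matrix of a null frame k = e_0, l = e_1, m_i = e_i (i >= 2). *)
Definition null_gram (i j : 'I_n) : R :=
  match val i, val j with
  | 0%N, 1%N | 1%N, 0%N => 1
  | i'.+2, j'.+2 => if i' == j' then 1 else 0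
  | _, _ => 0
  end.

Definition null_frame (a : chart M) (x : 'rV[R]_n) (E : 'I_n -> 'rV[R]_n) : Prop :=
  (forall i, val i = 0%N -> c a x (E i)) /\
  (forall i j, inner g a x (E i) (E j) = null_gram i j).

Definition boost_weight r (alpha : r.-tuple 'I_n) : int :=
  (count (fun i : 'I_n => val i == 0%N) alpha)%:Z -
  (count (fun i : 'I_n => val i == 1%N) alpha)%:Z.

Definition frame_component r (T : multilinear_form R n r) (E : 'I_n -> 'rV[R]_n)
    (alpha : r.-tuple 'I_n) : R :=
  eval T (fun s => E (tnth alpha s)).

(* Both predicates are imposed at every point and for every null frame. The zero
   tensor has boost order at most s for every s. *)
Definition boost_order_le r (T : components M r) (s : int) : Prop :=
  forall a x, cimg a x -> forall E, null_frame a x E ->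
    forall alpha, frame_component (T a x) E alpha != 0 -> boost_weight alpha <= s.

Definition boost_order_eq r (T : components M r) (s : int) : Prop :=
  boost_order_le T s /\
  forall a x, cimg a x -> forall E, null_frame a x E ->
    exists2 alpha, frame_component (T a x) E alpha != 0 & boost_weight alpha = s.

End Congruences.

(* Main.v *)
Require Import Defs.
From mathcomp Require Import all_boot all_order all_algebra.
From mathcomp Require Import all_classical all_reals.
From mathcomp Require Import topology normedtype derive.
From mathcomp Require Import perm ring.

Set Implicit Arguments.
Unset Strict Implicit.
Unset Printing Implicit Defensive.
Import Order.TTheory GRing.Theory Num.Theory.
Import numFieldNormedType.Exports.
Local Open Scope classical_set_scope.
Local Open Scope ring_scope.

(** Differentiation in a direction X raises boost orders only in so far as X moves
    the congruence. To see this, move a null frame k, l, m_i near a point so that k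
    stays on the congruence. If T has boost order at most b, its components of weight
    above b vanish identically in that frame, and the product rule leaves, for the
    components of nabla_X T of weight b + 1, only terms in which the connection
    replaces one frame vector by another of weight lower by one. The connection is
    metric, so that k is never replaced by l, and m_i is replaced by - kappa_i l
    when k is replaced by kappa_i m_i, where kappa_i = g(nabla_X k, m_i). Hence
    ([nabla_leading]) these components are, up to sign, the image of T under the
    infinitesimal null rotation N with vector kappa, acting as a derivation.

    For kappa different from zero, N together with its transpose and the boost
    spans a copy of sl(2), in which half the Cartan element is the boost weight
    ([nullrot_commutator]). On tensors, N therefore maps weight -1 injectively to
    weight 0, and N^2 maps weight -1 injectively to weight 1 ([nullrot_inj],
    [nullrot2_inj]). Both facts follow from the identity
    |N^T T|^2 = |N T|^2 + |kappa|^2 b |T|^2 for T of weight b ([nullrot_norm]),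
    in the Euclidean norm of the components.

    Now let W be of boost order -1 and t its part of weight -1, which is not zero.
    For X = k, the components of nabla_k W of weight 0 contribute weight 1 to
    nabla W; if they vanish then N t = 0, so that kappa = 0 and the congruence is
    geodetic ([kappa_congruence]). For X = m_p, the components of nabla_p nabla_p W
    with weight 1 in the indices of W are N^2 t; if they vanish then kappa = 0
    again ([kappa_transverse]). Since k and the m_p span the orthogonal complement
    of k, the congruence is Kundt. *)

(** * Derivations of the tensor algebra *)

Section Derivations.
Variables (R : realType) (n r : nat).
Implicit Types (T S : multilinear_form R n r) (A B : 'M[R]_n).
Implicit Types (alpha beta : r.-tuple 'I_n) (s t : 'I_r) (f h : 'I_n).

Definition upd beta s f : r.-tuple 'I_n :=
  [tuple (if t == s then f else tnth beta t) | t < r].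

Lemma tnth_upd beta s f t :
  tnth (upd beta s f) t = if t == s then f else tnth beta t.
Proof. exact: tnth_mktuple. Qed.

Lemma upd_upd beta s f h : upd (upd beta s f) s h = upd beta s h.
Proof. by apply: eq_from_tnth => t; rewrite !tnth_upd; case: eqP. Qed.

Lemma upd_id beta s : upd beta s (tnth beta s) = beta.
Proof. by apply: eq_from_tnth => t; rewrite tnth_upd; case: eqP => [->|]. Qed.

Lemma upd_comm beta s t f h : s != t ->
  upd (upd beta s f) t h = upd (upd beta t h) s f.
Proof.
move=> st; apply: eq_from_tnth => u; rewrite !tnth_upd.
by case: (eqVneq u t) => // ->; rewrite eq_sym (negbTE st).
Qed.

Lemma sum_upd (V : nmodType) s (G : r.-tuple 'I_n -> 'I_n -> V) :
  \sum_beta \sum_f G beta f = \sum_beta \sum_f G (upd beta s f) (tnth beta s).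
Proof.
rewrite !pair_big /=.
rewrite (reindex_inj (h := fun p => (upd p.1 s p.2, tnth p.1 s))) //=.
apply: inv_inj => -[beta f] /=.
by rewrite upd_upd upd_id tnth_upd eqxx.
Qed.

(** The action on covariant tensors, by derivation, of the endomorphism that sends
    the i-th frame vector to the i-th row of A. *)
Definition derv A T : multilinear_form R n r := fun beta =>
  \sum_(s < r) \sum_(f < n) A (tnth beta s) f * T (upd beta s f).

Lemma dervB A B T beta : derv (A - B) T beta = derv A T beta - derv B T beta.
Proof.
rewrite /derv -sumrB; apply: eq_bigr => s _; rewrite -sumrB.
by apply: eq_bigr => f _; rewrite !mxE mulrBl.
Qed.

Lemma dervZ a A T beta : derv (a *: A) T beta = a * derv A T beta.
Proof.
rewrite /derv mulr_sumr; apply: eq_bigr => s _; rewrite mulr_sumr.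
by apply: eq_bigr => f _; rewrite !mxE mulrA.
Qed.

(** Actions on different slots commute, so that only the terms acting twice on
    the same slot survive in the commutator. *)
Lemma derv_commutator A B T beta :
  derv A (derv B T) beta - derv B (derv A T) beta =
  derv (A *m B - B *m A) T beta.
Proof.
pose D (X Y : 'M[R]_n) s t := \sum_(f < n) \sum_(h < n)
  X (tnth beta s) f * Y (tnth beta t) h * T (upd (upd beta s f) t h).
have E X Y : derv X (derv Y T) beta =
    derv (X *m Y) T beta + \sum_(s < r) \sum_(t < r | t != s) D X Y s t.
  rewrite /derv -big_split; apply: eq_bigr => s _ /=.
  under eq_bigr => f _ do rewrite (bigD1 s) //= mulrDr.
  rewrite big_split /=; congr (_ + _).
    transitivity (\sum_(f < n) \sum_(h < n)
        X (tnth beta s) f * Y f h * T (upd beta s h)).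
      apply: eq_bigr => f _; rewrite mulr_sumr; apply: eq_bigr => h _.
      by rewrite tnth_upd eqxx upd_upd mulrA.
    by rewrite exchange_big; apply: eq_bigr => h _; rewrite -mulr_suml !mxE.
  transitivity (\sum_(f < n) \sum_(t < r | t != s) \sum_(h < n)
      X (tnth beta s) f * Y (tnth beta t) h * T (upd (upd beta s f) t h)).
    apply: eq_bigr => f _; rewrite mulr_sumr; apply: eq_bigr => t /negbTE ts.
    rewrite mulr_sumr; apply: eq_bigr => h _.
    by rewrite tnth_upd ts mulrA.
  by rewrite exchange_big.
have DC X Y : \sum_(s < r) \sum_(t < r | t != s) D X Y s t =
              \sum_(s < r) \sum_(t < r | t != s) D Y X s t.
  rewrite (exchange_big_dep xpredT) //=; apply: eq_bigr => s _.
  rewrite (eq_bigl (fun t => t != s)); last by move=> t; rewrite eq_sym.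
  apply: eq_bigr => t ts; rewrite /D exchange_big.
  apply: eq_bigr => f _; apply: eq_bigr => h _.
  by rewrite upd_comm // [X in X * _]mulrC.
by rewrite !E DC dervB [_ + _ as X in _ - X]addrC addrKA.
Qed.

(** It has no invariant meaning for a Lorentzian metric, but turns transposition of
    matrices into adjunction of derivations. *)
Definition dot S T : R := \sum_beta S beta * T beta.

Lemma dot_ge0 T : 0 <= dot T T.
Proof. by apply: sumr_ge0 => beta _; rewrite -expr2 sqr_ge0. Qed.

Lemma dot_eq0 T : dot T T = 0 -> forall beta, T beta = 0.
Proof.
move/eqP; rewrite psumr_eq0 => [/allP T0 beta|beta _]; last first.
  by rewrite -expr2 sqr_ge0.
by apply/eqP; rewrite -sqrf_eq0 expr2; apply: T0; rewrite mem_index_enum.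
Qed.

Lemma derv_adjoint A S T : dot (derv A S) T = dot S (derv A^T T).
Proof.
rewrite /dot /derv; under eq_bigr => beta _ do rewrite mulr_suml.
rewrite exchange_big [RHS](eq_bigr (fun beta => \sum_(s < r) S beta *
   \sum_(f < n) A^T (tnth beta s) f * T (upd beta s f))); last first.
  by move=> beta _; rewrite mulr_sumr.
rewrite [RHS]exchange_big; apply: eq_bigr => s _ /=.
under eq_bigr => beta _ do rewrite mulr_suml.
rewrite (sum_upd s); apply: eq_bigr => beta _; rewrite mulr_sumr.
apply: eq_bigr => f _; rewrite tnth_upd eqxx upd_upd upd_id mxE.
by rewrite -mulrA mulrCA.
Qed.

End Derivations.

(** * Boost weights and null rotations *)

Section NullRotations.
Variables (R : realType) (m r : nat).
Local Notation n := m.+2.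
Implicit Types (T : multilinear_form R n r) (beta : r.-tuple 'I_n).

Definition i0 : 'I_n := ord0.
Definition i1 : 'I_n := lift ord0 ord0.

Definition weight (i : 'I_n) : int := (i == i0)%:Z - (i == i1)%:Z.

Lemma boost_weightE beta : boost_weight beta = \sum_(s < r) weight (tnth beta s).
Proof.
rewrite /boost_weight sumrB -!sumn_count !sumnE !big_map !big_tuple.
rewrite -![in RHS](big_morph Posz PoszD (erefl _)).
by congr (_%:Z - _%:Z).
Qed.

Lemma boost_weight_upd beta s f : boost_weight (upd beta s f) =
  boost_weight beta - weight (tnth beta s) + weight f.
Proof.
rewrite !boost_weightE !(bigD1 s (P := xpredT)) //= tnth_upd eqxx.
rewrite (eq_bigr (fun t => weight (tnth beta t))) => [|t /negbTE ts]; first by ring.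
by rewrite tnth_upd ts.
Qed.

Definition boost_mx : 'M[R]_n := \matrix_(i, j) ((i == j)%:R * (weight i)%:~R).

Lemma derv_boost T beta : derv boost_mx T beta = (boost_weight beta)%:~R * T beta.
Proof.
rewrite boost_weightE rmorph_sum mulr_suml; apply: eq_bigr => s _.
rewrite (bigD1 (tnth beta s)) //= big1 ?addr0 => [|f /negbTE fs].
  by rewrite upd_id !mxE eqxx mul1r.
by rewrite mxE eq_sym fs !mul0r.
Qed.

Definition e0 : 'rV[R]_n := delta_mx 0 i0.
Definition e1 : 'rV[R]_n := delta_mx 0 i1.

(** For transverse kappa, the infinitesimal null rotation k |-> sum kappa_i m_i,
    m_i |-> - kappa_i l, l |-> 0. *)
Definition nullrot (kappa : 'rV[R]_n) : 'M[R]_n := e0^T *m kappa - kappa^T *m e1.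

Definition transverse (kappa : 'rV[R]_n) := kappa 0 i0 = 0 /\ kappa 0 i1 = 0.

Lemma nullrotE kappa i j :
  nullrot kappa i j = (i == i0)%:R * kappa 0 j - kappa 0 i * (j == i1)%:R.
Proof. by rewrite !mxE !big_ord1 !mxE !eqxx. Qed.

Lemma nullrot_weight kappa i j : transverse kappa -> nullrot kappa i j != 0 ->
  weight j = weight i - 1.
Proof.
move=> [k0 k1]; rewrite nullrotE /weight.
case: (eqVneq i i0) => [->|i_0].
  rewrite k0 mul0r subr0 mul1r; case: (eqVneq j i0) => [->|_]; rewrite ?k0 ?eqxx //.
  by case: (eqVneq j i1) => [->|_ //]; rewrite k1 eqxx.
rewrite mul0r sub0r; case: (eqVneq j i1) => [->|_]; last by rewrite mulr0 oppr0 eqxx.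
by case: (eqVneq i i1) => [->|_ //]; rewrite k1 mul0r oppr0 eqxx.
Qed.

(** The relation [e, f] = h of sl(2), up to the factor |kappa|^2. It holds because
    kappa is orthogonal, in the Euclidean sense, to both null directions. *)
Lemma nullrot_commutator kappa : transverse kappa ->
  nullrot kappa *m (nullrot kappa)^T - (nullrot kappa)^T *m nullrot kappa =
  (kappa *m kappa^T) 0 0 *: boost_mx.
Proof.
move=> [k0 k1].
have rk (i : 'I_n) : kappa *m (delta_mx 0 i : 'rV[R]_n)^T = (kappa 0 i)%:M.
  apply/matrixP => a b; rewrite !ord1 trmx_delta -colE !mxE eqxx.
  by [].
have kr (i : 'I_n) : (delta_mx 0 i : 'rV[R]_n) *m kappa^T = (kappa 0 i)%:M.
  by rewrite -[LHS]trmxK trmx_mul trmxK rk tr_scalar_mx.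
have dd (i j : 'I_n) : (delta_mx 0 i : 'rV[R]_n) *m (delta_mx 0 j)^T = ((i == j)%:R)%:M.
  rewrite trmx_delta mul_delta_mx_cond; apply/matrixP => a b.
  by rewrite !ord1 [i == j]eq_sym; case: (j == i); rewrite !mxE.
rewrite /nullrot /e0 /e1.
set q := (kappa *m kappa^T) 0 0.
have qE : kappa *m kappa^T = q%:M by apply/matrixP => a b; rewrite !ord1 [RHS]mxE.
rewrite !(linearB, trmx_mul, trmxK) /= !trmx_mul !trmxK !(mulmxBl, mulmxBr).
have mid (a : 'cV[R]_n) (b : 'rV[R]_n) (c : 'cV[R]_n) (d : 'rV[R]_n) x :
    b *m c = x%:M -> (a *m b) *m (c *m d) = x *: (a *m d).
  by move=> bc; rewrite -mulmxA (mulmxA b) bc mul_scalar_mx -scalemxAr.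
rewrite !(mid _ _ _ _ _ qE) !(mid _ _ _ _ _ (rk _)) !(mid _ _ _ _ _ (kr _)).
rewrite !(mid _ _ _ _ _ (dd _ _)).
rewrite k0 k1 !eqxx !scale0r !subr0 !scale1r !sub0r !opprK.
rewrite addrA addrK -scalerBr; congr (_ *: _).
apply/matrixP => i j; rewrite !mxE !big_ord1 !mxE !eqxx !andTb /weight.
rewrite rmorphB /=.
case: (eqVneq i j) => [<-|ij].
  by rewrite mul1r; case: (i == i0); case: (i == i1); rewrite !(mul1r, mul0r).
rewrite mul0r -!natrM !mulnb; apply/eqP; rewrite subr_eq0; apply/eqP; congr _%:R.
move: ij; case: (i =P i0) => [->|_]; last case: (i =P i1) => [->|_] //;
  by rewrite ?andbF //= (eq_sym _ j) => /negbTE ->.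
Qed.

Definition weight_part (b : int) T : multilinear_form R n r := fun beta =>
  if boost_weight beta == b then T beta else 0.

Definition homogeneous (b : int) T :=
  forall beta, boost_weight beta != b -> T beta = 0.

Lemma weight_part_homogeneous b T : homogeneous b (weight_part b T).
Proof. by rewrite /weight_part => beta /negbTE ->. Qed.

Lemma derv_nullrot_part kappa b T : transverse kappa ->
  derv (nullrot kappa) (weight_part b T) =
  weight_part (b + 1) (derv (nullrot kappa) T).
Proof.
move=> tk; apply/funext => beta; rewrite /weight_part /derv.
have [wb|wb] := eqVneq (boost_weight beta) (b + 1).
  apply: eq_bigr => s _; apply: eq_bigr => f _.
  have [->|/(nullrot_weight tk) wf] := eqVneq (nullrot kappa (tnth beta s) f) 0.
    by rewrite !mul0r.
  by rewrite boost_weight_upd wf wb ifT //; apply/eqP; ring.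
rewrite big1 // => s _; rewrite big1 // => f _.
have [->|/(nullrot_weight tk) wf] := eqVneq (nullrot kappa (tnth beta s) f) 0.
  by rewrite !mul0r.
rewrite boost_weight_upd wf ifF ?mulr0 //; apply: contraNF wb => /eqP <-.
by apply/eqP; ring.
Qed.

Lemma derv_nullrot_homogeneous kappa b T : transverse kappa ->
  homogeneous b T -> homogeneous (b + 1) (derv (nullrot kappa) T).
Proof.
move=> tk hT; have -> : T = weight_part b T.
  by apply/funext => beta; rewrite /weight_part; case: eqP => // /eqP /hT.
by rewrite derv_nullrot_part //; exact: weight_part_homogeneous.
Qed.

(** The commutator relation paired with T: the transpose is the adjoint, and the
    boost is multiplication by b on tensors of weight b. *)
Lemma nullrot_norm kappa b T : transverse kappa -> homogeneous b T ->
  dot (derv (nullrot kappa)^T T) (derv (nullrot kappa)^T T) =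
  dot (derv (nullrot kappa) T) (derv (nullrot kappa) T) +
  (kappa *m kappa^T) 0 0 * b%:~R * dot T T.
Proof.
move=> tk hT; set N := nullrot kappa.
rewrite !derv_adjoint trmxK /dot mulr_sumr -big_split /=.
apply: eq_bigr => beta _; rewrite mulrCA -mulrDr; congr (_ * _).
apply/eqP; rewrite addrC -subr_eq derv_commutator nullrot_commutator // dervZ.
rewrite derv_boost -mulrA; have [->|/hT ->] := eqVneq (boost_weight beta) b => //.
by rewrite !mulr0.
Qed.

(** Raising is injective on negative weights: in [nullrot_norm] the kernel makes
    the right-hand side a negative multiple of a norm. *)
Lemma nullrot_inj kappa b T : transverse kappa -> (kappa *m kappa^T) 0 0 != 0 ->
  homogeneous b T -> b < 0 -> (forall beta, derv (nullrot kappa) T beta = 0) ->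
  forall beta, T beta = 0.
Proof.
move=> tk kk hT b0 NT; apply: dot_eq0.
have kp : 0 < (kappa *m kappa^T) 0 0.
  rewrite lt_def kk mxE; apply: sumr_ge0 => i _.
  by rewrite mxE -expr2 sqr_ge0.
have := nullrot_norm tk hT.
rewrite [X in _ = X + _]big1 ?add0r => [E|beta _]; last by rewrite NT mul0r.
have := dot_ge0 (derv (nullrot kappa)^T T); rewrite E -mulrA pmulr_rge0 // => bT.
by apply/eqP; rewrite eq_le dot_ge0 andbT -(@nmulr_rge0 _ b%:~R) // ltrz0.
Qed.

(** Let u, of weight 0, be the null rotation of T. If u is annihilated by the null
    rotation, then also by its transpose, by [nullrot_norm] with b = 0. So u is
    orthogonal to itself, and [nullrot_inj] applies to T. *)
Lemma nullrot2_inj kappa T : transverse kappa -> (kappa *m kappa^T) 0 0 != 0 ->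
  homogeneous (- 1) T ->
  (forall beta, derv (nullrot kappa) (derv (nullrot kappa) T) beta = 0) ->
  forall beta, T beta = 0.
Proof.
move=> tk kk hT NNT; set u := derv (nullrot kappa) T.
have hu : homogeneous 0 u by exact: derv_nullrot_homogeneous tk hT.
have Fu beta : derv (nullrot kappa)^T u beta = 0.
  apply: dot_eq0; rewrite (nullrot_norm tk hu) mulr0 mul0r addr0.
  by rewrite /dot big1 // => gamma _; rewrite NNT mul0r.
apply: (nullrot_inj tk kk hT) => //; apply: dot_eq0.
by rewrite derv_adjoint /dot big1 // => gamma _; rewrite Fu mulr0.
Qed.

End NullRotations.

Arguments i0 {m}.
Arguments i1 {m}.

(** * Tensors in a frame *)

Section Pull.
Variables (R : realType) (n r : nat).
Implicit Types (T S : multilinear_form R n r) (A B F : 'M[R]_n).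
Implicit Types (alpha beta : r.-tuple 'I_n) (s t : 'I_r).

(** Components in the frame formed by the rows of F. *)
Definition pull T F : multilinear_form R n r := fun alpha =>
  frame_component T (fun i => row i F) alpha.

Lemma pullE T F alpha : pull T F alpha =
  \sum_beta T beta * \prod_(s < r) F (tnth alpha s) (tnth beta s).
Proof.
by apply: eq_bigr => beta _; congr (_ * _); apply: eq_bigr => s _; rewrite mxE.
Qed.

Lemma bigA_distr_tuple (G : 'I_r -> 'I_n -> R) :
  \prod_(s < r) \sum_(j < n) G s j =
  \sum_(gamma : r.-tuple 'I_n) \prod_(s < r) G s (tnth gamma s).
Proof.
rewrite bigA_distr_bigA /=.
rewrite (reindex (fun gamma : r.-tuple 'I_n => [ffun s => tnth gamma s])).
  by apply: eq_bigr => gamma _; apply: eq_bigr => s _; rewrite ffunE.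
exists (fun f : {ffun 'I_r -> 'I_n} => [tuple f s | s < r]) => f _.
  by apply: eq_from_tnth => s; rewrite tnth_mktuple ffunE.
by apply/ffunP => s; rewrite ffunE tnth_mktuple.
Qed.

Lemma pull_mul T B F : pull T (B *m F) = pull (pull T F) B.
Proof.
apply/funext => alpha; rewrite !pullE.
transitivity (\sum_(beta : r.-tuple 'I_n) \sum_(gamma : r.-tuple 'I_n)
    T beta * ((\prod_(s < r) B (tnth alpha s) (tnth gamma s)) *
              \prod_(s < r) F (tnth gamma s) (tnth beta s))).
  apply: eq_bigr => beta _; rewrite -mulr_sumr; congr (_ * _).
  under eq_bigr => s _ do rewrite mxE.
  by rewrite bigA_distr_tuple; apply: eq_bigr => gamma _; rewrite -big_split.
rewrite exchange_big; apply: eq_bigr => gamma _ /=.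
rewrite pullE mulr_suml; apply: eq_bigr => beta _.
by rewrite -mulrA [X in _ * X]mulrC.
Qed.

Lemma pull_cons (T : multilinear_form R n r.+1) F i alpha :
  frame_component T (fun i => row i F) [tuple of i :: alpha] =
  \sum_d F i d * pull (fun beta => T [tuple of d :: beta]) F alpha.
Proof.
rewrite /frame_component /Defs.eval.
rewrite (reindex (fun p : 'I_n * r.-tuple 'I_n =>
  [tuple of p.1 :: p.2] : r.+1.-tuple 'I_n)) /=; last first.
  exists (fun t : r.+1.-tuple 'I_n => (thead t, [tuple of behead t])) => [[d beta]|t] _.
    by rewrite theadE; congr pair; apply: val_inj.
  by rewrite [RHS]tuple_eta.
rewrite -(pair_big xpredT xpredT (fun d (beta : r.-tuple 'I_n) =>
   T [tuple of d :: beta] * \prod_(s < r.+1)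
    row (tnth [tuple of i :: alpha] s) F 0 (tnth [tuple of d :: beta] s))) /=.
apply: eq_bigr => d _; rewrite pullE mulr_sumr; apply: eq_bigr => beta _.
rewrite big_ord_recl mxE !tnth0 mulrCA; congr (_ * (_ * _)).
by apply: eq_bigr => s _; rewrite mxE !tnthS.
Qed.

(** The first variation of [pull T] at F in the direction B. *)
Definition pull_diff T F B : multilinear_form R n r := fun alpha =>
  \sum_(s < r) \sum_beta T beta *
    (B (tnth alpha s) (tnth beta s) *
     \prod_(t < r | t != s) F (tnth alpha t) (tnth beta t)).

Lemma pull_diffD T F B B' alpha :
  pull_diff T F (B + B') alpha = pull_diff T F B alpha + pull_diff T F B' alpha.
Proof.
rewrite /pull_diff -big_split; apply: eq_bigr => s _ /=.
rewrite -big_split; apply: eq_bigr => beta _ /=.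
by rewrite mxE mulrDl mulrDr.
Qed.

(** Acting on the left, A combines the vectors of the frame and so acts on the
    components; acting on the right it acts on the tensor itself. *)
Lemma pull_diff_mull T F A alpha :
  pull_diff T F (A *m F) alpha = derv A (pull T F) alpha.
Proof.
apply: eq_bigr => s _; under [RHS]eq_bigr => f _ do rewrite pullE mulr_sumr.
rewrite exchange_big; apply: eq_bigr => beta _.
rewrite !mxE mulr_suml mulr_sumr; apply: eq_bigr => f _.
rewrite [in RHS](bigD1 s) //= tnth_upd eqxx mulrCA -!mulrA.
congr (_ * _); rewrite mulrCA; do 2 congr (_ * _).
by apply: eq_bigr => t /negbTE ts; rewrite tnth_upd ts.
Qed.

Lemma pull_diff_mulr T F A alpha :
  pull_diff T F (F *m A) alpha = pull (derv A T) F alpha.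
Proof.
rewrite pullE; under [RHS]eq_bigr => beta _ do rewrite mulr_suml.
rewrite exchange_big; apply: eq_bigr => s _ /=.
under [RHS]eq_bigr => beta _ do rewrite mulr_suml.
rewrite (sum_upd s); apply: eq_bigr => beta _.
rewrite !mxE mulr_suml mulr_sumr; apply: eq_bigr => f _.
rewrite [in RHS](bigD1 s) //= !tnth_upd eqxx upd_upd upd_id.
rewrite [in RHS](eq_bigr (fun t => F (tnth alpha t) (tnth beta t))).
  by ring.
by move=> t /negbTE ts; rewrite tnth_upd ts.
Qed.

End Pull.

(** * Matrices that do not lower the boost weight *)

Section WeightRaising.
Variables (R : realType) (m r : nat).
Local Notation n := m.+2.
Implicit Types (T : multilinear_form R n r) (alpha : r.-tuple 'I_n).

Definition weight_nonlowering (B : 'M[R]_n) :=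
  forall i j, B i j != 0 -> weight i <= weight j.

Definition weight_le (b : int) T :=
  forall alpha, b < boost_weight alpha -> T alpha = 0.

(** Components of weight above b in the new frame are combinations of components
    of at least that weight in the old one. *)
Lemma pull_weight_le b B T :
  weight_nonlowering B -> weight_le b T -> weight_le b (pull T B).
Proof.
move=> hB hT alpha wa; rewrite pullE big1 // => beta _.
have [B0|] := eqVneq (\prod_(s < r) B (tnth alpha s) (tnth beta s)) 0.
  by rewrite B0 mulr0.
move/prodf_neq0 => B0; rewrite hT ?mul0r //; apply: lt_le_trans wa _.
by rewrite !boost_weightE; apply: ler_sum => s _; apply/hB/B0.
Qed.

Lemma derv_nonlowering b B T alpha : weight_nonlowering B -> weight_le b T ->
  b < boost_weight alpha -> derv B T alpha = 0.
Proof.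
move=> hB hT wa; rewrite /derv big1 // => s _; rewrite big1 // => f _.
have [->|/hB wf] := eqVneq (B (tnth alpha s) f) 0; first by rewrite mul0r.
by rewrite hT ?mulr0 // boost_weight_upd -addrA ltr_wpDr // addrC subr_ge0.
Qed.

(** The transverse part of the image of k. If A preserves the metric to first
    order, the null rotation with this vector is the part of A that lowers
    weights, see [nullrot_nonlowering]. *)
Definition lowering_vec (A : 'M[R]_n) : 'rV[R]_n :=
  \row_j (if (j == i0) || (j == i1) then 0 else A i0 j).

Lemma lowering_vec_transverse A : transverse (lowering_vec A).
Proof. by split; rewrite mxE. Qed.

Lemma nullrot_nonlowering (A : 'M[R]_n) : A i0 i1 = 0 ->
  (forall i, i != i0 -> i != i1 -> A i i1 = - A i0 i) ->
  weight_nonlowering (A - nullrot (lowering_vec A)).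
Proof.
move=> A01 A1 i j; apply: contraR; rewrite -ltNge => wij.
rewrite [X in X == 0]mxE [X in _ + X]mxE nullrotE !mxE.
move: wij; rewrite /weight.
have [->|i_0] := eqVneq i i0; last first.
  have [->|i_1] := eqVneq i i1; first by case: eqP; case: eqP.
  have [->|j_1] := eqVneq j i1; last by case: eqP.
  by move=> _; rewrite (A1 i) //= mul0r mulr1 sub0r opprK addNr.
rewrite /=.
have [->|j_0] := eqVneq j i0; first by rewrite ltxx.
have [->|j_1] := eqVneq j i1; first by move=> _; rewrite A01 mulr0 mul0r !subr0.
by move=> _; rewrite mul1r mul0r subr0 subrr.
Qed.

Lemma nullrot_weight_le kappa b T : transverse kappa ->
  weight_le b T -> weight_le (b + 1) (derv (nullrot kappa) T).
Proof.
move=> tk hT alpha wa; rewrite /derv big1 // => s _; rewrite big1 // => f _.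
have [->|/(nullrot_weight tk) wf] := eqVneq (nullrot kappa (tnth alpha s) f) 0.
  by rewrite mul0r.
by rewrite hT ?mulr0 // boost_weight_upd wf addrA addrNK ltrBrDr.
Qed.

Lemma derv_nullrot b (A : 'M[R]_n) T alpha : A i0 i1 = 0 ->
  (forall i, i != i0 -> i != i1 -> A i i1 = - A i0 i) ->
  weight_le b T -> b < boost_weight alpha ->
  derv A T alpha = derv (nullrot (lowering_vec A)) T alpha.
Proof.
move=> A01 A1 hT wa; apply/eqP; rewrite -subr_eq0 -dervB.
by rewrite (derv_nonlowering (nullrot_nonlowering A01 A1) hT wa).
Qed.

End WeightRaising.

(** * Null frames *)

Section NullFrames.
Variables (R : realType) (m : nat).
Local Notation n := m.+2.
Implicit Types (G F B : 'M[R]_n) (u v w k : 'rV[R]_n) (i j : 'I_n).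

Definition ip G u v : R := (u *m G *m v^T) 0 0.

Lemma ipDl G u v w : ip G (u + v) w = ip G u w + ip G v w.
Proof. by rewrite /ip !mulmxDl mxE. Qed.

Lemma ipZl G a u w : ip G (a *: u) w = a * ip G u w.
Proof. by rewrite /ip -!scalemxAl mxE. Qed.

Lemma ipC G u v : G^T = G -> ip G u v = ip G v u.
Proof.
by move=> Gs; rewrite /ip -[u *m G *m v^T]trmxK mxE !trmx_mul trmxK Gs mulmxA.
Qed.

Lemma ipDr G u v w : ip G u (v + w) = ip G u v + ip G u w.
Proof. by rewrite /ip linearD mulmxDr mxE. Qed.

Lemma ipZr G a u w : ip G u (a *: w) = a * ip G u w.
Proof. by rewrite /ip linearZ -scalemxAr mxE. Qed.

Lemma ipE G F B i j : ip G (row i F) (row j B) = (F *m G *m B^T) i j.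
Proof.
rewrite /ip tr_row -row_mul [LHS]mxE [RHS]mxE; apply: eq_bigr => l _.
by rewrite [row _ _ _ _]mxE [col _ _ _ _]mxE.
Qed.

(** Exchanges k and l; the index of the vector dual to e_i. *)
Definition dual i : 'I_n := tperm i0 i1 i.

Lemma dualK : involutive dual. Proof. exact: tpermK. Qed.

Lemma null_gramE i j : null_gram R i j = (dual i == j)%:R.
Proof.
rewrite /dual; case: tpermP => [->|->|/eqP i_0 /eqP i_1].
- by case: j => -[|[|j]] jn.
- by case: j => -[|[|j]] jn.
case: i i_0 i_1 => -[|[|i]] // hi _ _; case: j => -[|[|j]] hj //.
by rewrite /null_gram /= -val_eqE /= !eqSS; case: eqP.
Qed.

Definition null_mx : 'M[R]_n := \matrix_(i, j) null_gram R i j.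

Definition null_basis G F := F *m G *m F^T = null_mx.

Lemma mul_null_mx p (B : 'M[R]_(p, n)) (i : 'I_p) j :
  (B *m null_mx) i j = B i (dual j).
Proof.
rewrite mxE (bigD1 (dual j)) //= big1 => [|l lj].
  by rewrite mxE null_gramE dualK eqxx mulr1 addr0.
by rewrite mxE null_gramE -(inj_eq (can_inj dualK)) dualK (negbTE lj) mulr0.
Qed.

Lemma null_mxK : null_mx *m null_mx = 1%:M.
Proof.
apply/matrixP => i j.
by rewrite mul_null_mx !mxE null_gramE (inj_eq (can_inj dualK)).
Qed.

Lemma null_basis_unit G F : null_basis G F -> F \in unitmx.
Proof.
move=> FG; have : null_mx \in unitmx by have [] := mulmx1_unit null_mxK.
by rewrite -FG -mulmxA unitmx_mul => /andP[].
Qed.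

(** Coordinates are inner products with the dual basis, whose matrix relative to F is
    [null_mx]. *)
Lemma null_basis_coord G F p (V : 'M[R]_(p, n)) : null_basis G F ->
  V = V *m G *m F^T *m null_mx *m F.
Proof.
move=> FG; have : F *m (G *m F^T *m null_mx) = 1%:M by rewrite !mulmxA FG null_mxK.
by move/mulmx1C => E; rewrite -[LHS]mulmx1 -E !mulmxA.
Qed.

Lemma null_basisP G F : null_basis G F <->
  forall i j, ip G (row i F) (row j F) = null_gram R i j.
Proof.
split=> [FG i j|FG]; first by rewrite ipE FG mxE.
by apply/matrixP => i j; rewrite -ipE FG mxE.
Qed.

Lemma dual0 : dual i0 = i1. Proof. exact: tpermL. Qed.
Lemma dual1 : dual i1 = i0. Proof. exact: tpermR. Qed.

Lemma indexP i : [\/ i = i0, i = i1 |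
  [/\ (i == i0) = false, (i == i1) = false & dual i = i]].
Proof.
have [->|i_0] := eqVneq i i0; first exact: Or31.
have [->|i_1] := eqVneq i i1; first exact: Or32.
by apply: Or33; rewrite /dual tpermD // eq_sym.
Qed.

Lemma minkowski_null_basis P G : P *m G *m P^T = minkowski_mx R n ->
  exists F, null_basis G F.
Proof.
move=> PG; exists (\matrix_i
  if i == i0 then row i0 P + row i1 P
  else if i == i1 then 2^-1 *: (row i1 P + (-1) *: row i0 P) else row i P).
have Pij i j : ip G (row i P) (row j P) =
    if i == j then if i == i0 then -1 else 1 else 0.
  by rewrite ipE PG mxE.
apply/null_basisP => i j; rewrite !rowK null_gramE.
case: (indexP i) => [->|->|[i_0 i_1 di]]; case: (indexP j) => [->|->|[j_0 j_1 _]];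
  rewrite ?dual0 ?dual1 ?di ?i_0 ?i_1 ?j_0 ?j_1 ?(ipDl, ipDr, ipZl, ipZr) !Pij;
  rewrite ?(eq_sym i0) ?(eq_sym i1) ?i_0 ?i_1 ?j_0 ?j_1 ?eqxx /=; try by field.
by case: eqP.
Qed.

(** A null vector k off the hyperplane orthogonal to F_1 can be taken as first
    vector, F_1 being rescaled and the others projected along F_1. *)
Lemma null_basis_step G F k : G^T = G -> null_basis G F -> ip G k k = 0 ->
  ip G k (row i1 F) != 0 -> exists2 F', null_basis G F' & row i0 F' = k.
Proof.
move=> Gs /null_basisP FG kk; set a := ip G k _ => a0.
exists (\matrix_i if i == i0 then k
  else if i == i1 then a^-1 *: row i1 F
  else row i F + (- (ip G k (row i F) / a)) *: row i1 F); last by rewrite rowK.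
have kF i : ip G (row i F) k = ip G k (row i F) by rewrite ipC.
have FFE i j : ip G (row i F) (row j F) = (dual i == j)%:R by rewrite FG null_gramE.
apply/null_basisP => i j; rewrite !rowK null_gramE.
case: (indexP i) => [->|->|[i_0 i_1 di]]; case: (indexP j) => [->|->|[j_0 j_1 dj]];
  rewrite ?dual0 ?dual1 ?di ?i_0 ?i_1 ?j_0 ?j_1 ?(ipDl, ipDr, ipZl, ipZr) ?FFE ?kF ?kk -/a;
  rewrite ?dual0 ?dual1 ?di ?(eq_sym i0) ?(eq_sym i1) ?i_0 ?i_1 ?j_0 ?j_1 ?eqxx /=;
  try by [field|field; exact a0].
Qed.

(** Failing that, F_0 and F_1 are exchanged; a null vector orthogonal to both
    would have vanishing transverse components as well. *)
Lemma null_basis_null_vector G F k : G^T = G -> null_basis G F -> ip G k k = 0 ->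
  k != 0 -> exists2 F', null_basis G F' & row i0 F' = k.
Proof.
move=> Gs FG kk k0; have [kF1|kF1] := eqVneq (ip G k (row i1 F)) 0; last first.
  exact: null_basis_step kF1.
have rowN i : row i (null_mx *m F) = row (dual i) F.
  apply/rowP => j; rewrite !mxE (bigD1 (dual i)) //= big1 => [|l li].
    by rewrite mxE null_gramE eqxx mul1r addr0.
  by rewrite mxE null_gramE eq_sym (negbTE li) mul0r.
have FG' : null_basis G (null_mx *m F).
  apply/null_basisP => i j; rewrite !rowN; move/null_basisP: FG => ->.
  by rewrite !null_gramE (inj_eq (can_inj dualK)).
apply: (null_basis_step Gs FG') => //; rewrite rowN dual1.
apply: contra k0 => /eqP kF0.
set c := k *m G *m F^T *m null_mx.
have kE : k = c *m F by exact: null_basis_coord.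
have cE j : c 0 j = ip G k (row (dual j) F).
  rewrite /c mul_null_mx /ip [LHS]mxE [RHS]mxE; apply: eq_bigr => l _.
  by congr (_ * _); rewrite !mxE.
have : \sum_j c 0 j ^+ 2 = 0.
  rewrite -[RHS]kk /ip kE trmx_mul !mulmxA -(mulmxA c) -(mulmxA c) FG.
  rewrite [RHS]mxE; apply: eq_bigr => j _; rewrite mul_null_mx [c^T _ _]mxE.
  rewrite expr2; case: (indexP j) => [->|->|[_ _ ->] //].
    by rewrite dual0 !cE dual0 kF1 !mulr0.
  by rewrite dual1 !cE dual1 kF0 !mulr0.
move/eqP; rewrite psumr_eq0 => [/allP c0|j _]; last exact: sqr_ge0.
suff -> : k = 0 by [].
rewrite kE; suff -> : c = 0 by rewrite mul0mx.
apply/rowP => j; rewrite [RHS]mxE; apply/eqP; rewrite -sqrf_eq0; apply: c0.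
exact: mem_index_enum.
Qed.

End NullFrames.

Arguments dualK {m}.

(** * Directional derivatives of sums, products and inverse matrices *)

Section DerivativeRules.
Variables (R : realType) (V : normedModType R).
Implicit Types (x v : V).

Lemma is_derive_bigsum (I : Type) (s : seq I) (f : I -> V -> R) (df : I -> R) x v :
  (forall i, is_derive x v (f i) (df i)) ->
  is_derive x v (fun y => \sum_(i <- s) f i y) (\sum_(i <- s) df i).
Proof.
move=> fdf; elim: s => [|i s IH].
  rewrite big_nil; under eq_fun do rewrite big_nil.
  exact: is_derive_cst.
rewrite big_cons; under eq_fun do rewrite big_cons.
exact: is_deriveD.
Qed.

Lemma is_derive_bigprod (I : eqType) (s : seq I) (f : I -> V -> R) (df : I -> R) x v :
  uniq s -> (forall i, is_derive x v (f i) (df i)) ->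
  is_derive x v (fun y => \prod_(i <- s) f i y)
    (\sum_(i <- s) df i * \prod_(j <- s | j != i) f j x).
Proof.
move=> + fdf; elim: s => [_|i s IH /= /andP[iNs us]].
  rewrite big_nil; under eq_fun do rewrite big_nil.
  exact: is_derive_cst.
under eq_fun do rewrite big_cons.
apply: (is_derive_eq (is_deriveM (fdf i) (IH us))); rewrite big_cons addrC; congr (_ + _).
  rewrite big_cons eqxx /= [RHS]mulrC; congr (_ * _).
  rewrite [in RHS]big_seq_cond [in LHS]big_seq; apply: eq_bigl => j.
  by case: (eqVneq j i) => [->|]; rewrite ?andbT // (negbTE iNs).
rewrite /GRing.scale /= mulr_sumr [LHS]big_seq [RHS]big_seq.
apply: eq_bigr => j js.
rewrite big_cons ifT 1?mulrCA //.
by apply: contraNneq iNs => ->.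
Qed.

Lemma derivable_bigsum (I : Type) (s : seq I) (f : I -> V -> R) x v :
  (forall i, derivable (f i) x v) -> derivable (fun y => \sum_(i <- s) f i y) x v.
Proof.
move=> df; have dfP i := derivableP (df i).
by case: (is_derive_bigsum s dfP).
Qed.

Lemma derivable_bigprod (I : finType) (f : I -> V -> R) x v :
  (forall i, derivable (f i) x v) -> derivable (fun y => \prod_i f i y) x v.
Proof.
move=> df; have dfP i := derivableP (df i).
by case: (is_derive_bigprod (index_enum_uniq I) dfP).
Qed.

Lemma derivable_det p (A : V -> 'M[R]_p) x v :
  (forall i j, derivable (fun y => A y i j) x v) -> derivable (fun y => \det (A y)) x v.
Proof.
move=> dA; apply: derivable_bigsum => s.
by apply: derivableM; [exact: derivable_cst|exact: derivable_bigprod].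
Qed.

Lemma derivable_invmx p (A : V -> 'M[R]_p) x v :
  (\forall y \near x, A y \in unitmx) ->
  (forall i j, derivable (fun y => A y i j) x v) ->
  forall i j, derivable (fun y => invmx (A y) i j) x v.
Proof.
move=> uA dA i j.
apply: (@near_eq_derivable _ _ _ (fun y => (\det (A y))^-1 * cofactor (A y) j i)).
  near=> y; rewrite /invmx ifT; first by rewrite !mxE.
  by near: y.
apply: derivableM.
  apply: derivableV; last exact: derivable_det.
  by rewrite -unitfE -unitmxE; exact: nbhs_singleton uA.
apply: derivableM; first exact: derivable_cst.
apply: derivable_det => i' j'.
rewrite (_ : (fun y => _) = (fun y => A y (lift j i') (lift i j'))) //.
by apply/funext => y; rewrite !mxE.
Unshelve. all: by end_near. Qed.

End DerivativeRules.

(** * Covariant derivatives in a moving frame *)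

Section MovingFrame.
Variables (R : realType) (n r : nat) (M : manifold R n) (g : lorentz_metric M).
Variables (a : chart M) (x : 'rV[R]_n).
Implicit Types (T : components M r) (alpha beta : r.-tuple 'I_n).
Implicit Types (F : 'rV[R]_n -> 'M[R]_n) (d : 'I_n).

Definition connection_mx d : 'M[R]_n := \matrix_(i, f) christoffel g a x f d i.

Lemma nabla_consE T d beta : nabla g T a x [tuple of d :: beta] =
  partial d (fun y => T a y beta) x - derv (connection_mx d) (T a x) beta.
Proof.
rewrite /nabla theadE.
have -> : [tuple of behead [tuple of d :: beta]] = beta by apply: val_inj.
by congr (_ - _); apply: eq_bigr => s _; apply: eq_bigr => f _; rewrite mxE.
Qed.

Definition partial_mx d F : 'M[R]_n := \matrix_(i, j) partial d (fun y => F y i j) x.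

(** The derivatives of the vectors of the frame, as rows. *)
Definition frame_deriv d F : 'M[R]_n := partial_mx d F + F x *m connection_mx d.

Lemma is_derive_pull T F d alpha :
  (forall beta, derivable (fun y => T a y beta) x (delta_mx 0 d)) ->
  (forall i j, derivable (fun y => F y i j) x (delta_mx 0 d)) ->
  partial d (fun y => pull (T a y) (F y) alpha) x =
  pull (fun beta => partial d (fun y => T a y beta) x) (F x) alpha +
  pull_diff (T a x) (F x) (partial_mx d F) alpha.
Proof.
move=> dT dF; rewrite /partial; under eq_fun do rewrite pullE.
pose P (beta : r.-tuple 'I_n) y := \prod_(s < r) F y (tnth alpha s) (tnth beta s).
have dP (beta : r.-tuple 'I_n) : is_derive x (delta_mx 0 d) (P beta)
    (\sum_(s < r) partial_mx d F (tnth alpha s) (tnth beta s) *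
       \prod_(t < r | t != s) F x (tnth alpha t) (tnth beta t)).
  apply: is_derive_bigprod; first exact: index_enum_uniq.
  by move=> s; rewrite mxE; exact: derivableP.
have dTP beta := is_deriveM (derivableP (dT beta)) (dP beta).
have [_ ->] := is_derive_bigsum (index_enum (r.-tuple 'I_n)) dTP.
rewrite big_split /= addrC; congr (_ + _); last first.
  rewrite /pull_diff exchange_big; apply: eq_bigr => beta _.
  by rewrite /GRing.scale /= mulr_sumr.
by rewrite pullE; apply: eq_bigr => beta _; rewrite /GRing.scale /= mulrC.
Qed.

(** The Christoffel symbols act on the tensor, hence by [pull_diff_mulr] they can be
    moved to the vectors of the frame. *)
Lemma pull_nabla T F d alpha :
  (forall beta, derivable (fun y => T a y beta) x (delta_mx 0 d)) ->
  (forall i j, derivable (fun y => F y i j) x (delta_mx 0 d)) ->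
  pull (fun beta => nabla g T a x [tuple of d :: beta]) (F x) alpha =
  partial d (fun y => pull (T a y) (F y) alpha) x -
  pull_diff (T a x) (F x) (frame_deriv d F) alpha.
Proof.
move=> dT dF; rewrite is_derive_pull // pull_diffD pull_diff_mulr opprD addrA addrK.
rewrite !pullE -sumrB; apply: eq_bigr => beta _.
by rewrite nabla_consE mulrBl.
Qed.

(** The connection form along X: the derivative of each vector of the frame,
    expanded in the frame. *)
Definition frame_conn F (X : 'rV[R]_n) : 'M[R]_n :=
  (\sum_d X 0 d *: frame_deriv d F) *m invmx (F x).

(** The product rule, when the derivative of the component itself drops out. *)
Lemma nabla_vanishing T F (X : 'rV[R]_n) alpha : F x \in unitmx ->
  (forall d beta, derivable (fun y => T a y beta) x (delta_mx 0 d)) ->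
  (forall d i j, derivable (fun y => F y i j) x (delta_mx 0 d)) ->
  (\forall y \near x, pull (T a y) (F y) alpha = 0) ->
  \sum_d X 0 d * pull (fun beta => nabla g T a x [tuple of d :: beta]) (F x) alpha =
  - derv (frame_conn F X) (pull (T a x) (F x)) alpha.
Proof.
move=> Fu dT dF T0; rewrite -pull_diff_mull /frame_conn mulmxKV //.
have -> : pull_diff (T a x) (F x) (\sum_d X 0 d *: frame_deriv d F) alpha =
    \sum_d X 0 d * pull_diff (T a x) (F x) (frame_deriv d F) alpha.
  rewrite /pull_diff; under [RHS]eq_bigr => d _ do rewrite mulr_sumr.
  rewrite [RHS]exchange_big; apply: eq_bigr => s _ /=.
  under [RHS]eq_bigr => d _ do rewrite mulr_sumr.
  rewrite [RHS]exchange_big; apply: eq_bigr => beta _ /=.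
  rewrite summxE mulr_suml mulr_sumr; apply: eq_bigr => d _.
  by rewrite mxE; ring.
rewrite -sumrN; apply: eq_bigr => d _; rewrite pull_nabla //.
have -> : partial d (fun y => pull (T a y) (F y) alpha) x = 0.
  rewrite /partial (@near_eq_derive _ _ _ _ (cst 0)); last exact: T0.
  exact: derive_cst.
by rewrite sub0r mulrN.
Qed.

Lemma nabla_vec_frame F (X : 'rV[R]_n) i : F x \in unitmx ->
  nabla_vec g a x X (fun y => row i (F y)) = row i (frame_conn F X *m F x).
Proof.
move=> Fu; rewrite mulmxKV //; apply/rowP => b; rewrite !mxE summxE.
apply: eq_bigr => d _; rewrite !mxE; congr (_ * (_ + _)).
  by congr (partial _ _ _); apply/funext => y; rewrite mxE.
by apply: eq_bigr => e _; rewrite !mxE mulrC.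
Qed.

End MovingFrame.

(** * Differentiability of the components *)

Section Smoothness.
Variables (R : realType) (n : nat) (M : manifold R n) (g : lorentz_metric M).
Variables (a : chart M) (x : 'rV[R]_n) (ax : cimg a x).

Lemma near_cimg : \forall y \near x, cimg a y.
Proof. by apply: open_nbhs_nbhs; split => //; exact: cimg_open. Qed.

Lemma smooth_derivable (U : set 'rV[R]_n) f d : smooth_on U f -> U x ->
  derivable f x (delta_mx 0 d).
Proof. by move=> /(_ 1%N)[_ /(_ d)[df _]]; exact: df. Qed.

Lemma smooth_partial (U : set 'rV[R]_n) (f : 'rV[R]_n -> R) d :
  smooth_on U f -> smooth_on U (partial d f).
Proof. by move=> sf k; have [_ /(_ d)[]] := sf k.+1. Qed.

Lemma metric_mx_derivable d i j :
  derivable (fun y => metric_mx g a y i j) x (delta_mx 0 d).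
Proof.
rewrite (_ : (fun y => metric_mx g a y i j) = fun y => tcomp g a y [tuple i; j]).
  exact: smooth_derivable (tcomp_smooth g a [tuple i; j]) ax.
by apply/funext => y; rewrite mxE.
Qed.

Lemma partial_metric_mx_derivable d e i j :
  derivable (partial e (fun y => metric_mx g a y i j)) x (delta_mx 0 d).
Proof.
rewrite (_ : (fun y => metric_mx g a y i j) = fun y => tcomp g a y [tuple i; j]).
  exact: smooth_derivable (smooth_partial e (tcomp_smooth g a [tuple i; j])) ax.
by apply/funext => y; rewrite mxE.
Qed.

Lemma christoffel_derivable d i j k :
  derivable (fun y => christoffel g a y i j k) x (delta_mx 0 d).
Proof.
apply: derivableM; first exact: derivable_cst.
apply: derivable_bigsum => l; apply: derivableM.
  apply: derivable_invmx; last exact: metric_mx_derivable.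
  by apply: filterS near_cimg => y; exact: metric_mx_unit.
apply: derivableB; last exact: partial_metric_mx_derivable.
by apply: derivableD; exact: partial_metric_mx_derivable.
Qed.

Lemma nabla_derivable r (T : tensor_field M r) d alpha :
  derivable (fun y => nabla g T a y alpha) x (delta_mx 0 d).
Proof.
apply: derivableB.
  exact: smooth_derivable (smooth_partial _ (tcomp_smooth T a _)) ax.
apply: derivable_bigsum => s; apply: derivable_bigsum => f.
apply: derivableM; first exact: christoffel_derivable.
exact: smooth_derivable (tcomp_smooth T a _) ax.
Qed.

End Smoothness.

(** * Frames adapted to the null congruence *)

Lemma derv_cons (R : realType) n r (A : 'M[R]_n) (T : multilinear_form R n r.+1)
    i (alpha : r.-tuple 'I_n) :
  derv A T [tuple of i :: alpha] =
  \sum_f A i f * T [tuple of f :: alpha] +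
  derv A (fun beta => T [tuple of i :: beta]) alpha.
Proof.
rewrite /derv big_ord_recl; congr (_ + _).
  apply: eq_bigr => f _; rewrite tnth0; congr (_ * T _).
  apply: eq_from_tnth => s; rewrite tnth_upd.
  by case: (unliftP ord0 s) => [t ->|->]; rewrite ?tnth0 ?tnthS.
apply: eq_bigr => s _; apply: eq_bigr => f _; rewrite tnthS; congr (_ * T _).
apply: eq_from_tnth => t; rewrite tnth_upd.
by case: (unliftP ord0 t) => [u ->|->]; rewrite ?tnth0 ?tnthS ?tnth_upd ?(inj_eq lift_inj).
Qed.

Lemma boost_weight_cons m r i (alpha : r.-tuple 'I_m.+2) :
  boost_weight [tuple of i :: alpha] = weight i + boost_weight alpha.
Proof.
rewrite !boost_weightE big_ord_recl tnth0; congr (_ + _).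
by apply: eq_bigr => s _; rewrite tnthS.
Qed.

Lemma pull2E (R : realType) n (T : multilinear_form R n 2) F i j :
  pull T F [tuple i; j] = (F *m bilin_mx T *m F^T) i j.
Proof.
rewrite pullE (reindex (fun p : 'I_n * 'I_n => [tuple p.1; p.2])) /=; last first.
  exists (fun t => (tnth t ord0, tnth t ord_max)) => [[p q]|t] _ //.
  apply: eq_from_tnth => -[[|[|]]] // lt_s; rewrite (tnth_nth (tnth t ord0)) /=;
    by congr tnth; apply: val_inj.
rewrite -(pair_big xpredT xpredT (fun p q => T [tuple p; q] * \prod_(s < 2)
   F (tnth [tuple i; j] s) (tnth [tuple p; q] s))) /= exchange_big mxE.
apply: eq_bigr => q _; rewrite !mxE mulr_suml; apply: eq_bigr => p _.
by rewrite !big_ord_recl big_ord0 /= mxE; rewrite /tnth /=; ring.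
Qed.

Section AdaptedFrame.
Variables (R : realType) (m : nat).
Local Notation n := m.+2.
Variables (M : manifold R n) (g : lorentz_metric M) (c : null_congruence g).
Variables (a : chart M) (V : set 'rV[R]_n) (k : 'rV[R]_n -> 'rV[R]_n).
Hypothesis sec : local_section c a V k.

Local Notation G := (metric_mx g a).

Lemma section_null_basis y : V y -> exists2 F, null_basis (G y) F & row i0 F = k y.
Proof.
have [_ Va _ ck] := sec; move=> Vy; have [k0 cy] := ck y Vy.
have ay := Va y Vy.
have [P _ /minkowski_null_basis[F FG]] := metric_signature g ay.
apply: (null_basis_null_vector _ FG _ k0); first exact: (metric_mx_sym g ay).
by have := line_null ay cy.
Qed.

Lemma null_basis_null_frame y F : V y -> null_basis (G y) F -> row i0 F = k y ->
  null_frame c a y (fun i => row i F).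
Proof.
have [_ _ _ ck] := sec; move=> Vy /null_basisP FG F0; split=> // i i_0.
by rewrite (_ : i = i0) ?F0; [have [] := ck y Vy|apply: val_inj].
Qed.

Lemma boost_order_weight_le y F r (T : components M r) b : V y ->
  null_basis (G y) F -> row i0 F = k y -> boost_order_le c T b ->
  weight_le b (pull (T a y) F).
Proof.
have [_ Va _ _] := sec; move=> Vy FG F0 Tb alpha; rewrite ltNge => wa; apply/eqP.
by apply: contraNT wa; apply: Tb (null_basis_null_frame Vy FG F0) _; exact: Va.
Qed.

Variables (x : 'rV[R]_n) (E : 'M[R]_n).
Hypotheses (Vx : V x) (EG : null_basis (G x) E) (E0 : row i0 E = k x).

Let ax : cimg a x. Proof. by have [_ Va _ _] := sec; exact: Va. Qed.

(** Near x the vectors of E are moved so that the first one stays on the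
    congruence and all but the second stay orthogonal to it; for boost orders no
    more is required than this, see [adapted_weight_le]. *)
Definition adapted (y : 'rV[R]_n) : 'M[R]_n := \matrix_i
  if i == i0 then k y else if i == i1 then row i1 E
  else row i E + (- (ip (G y) (row i E) (k y) / ip (G y) (row i1 E) (k y))) *: row i1 E.

Let ipx i : ip (G x) (row i E) (k x) = (dual i == i0)%:R.
Proof. by rewrite -E0; move/null_basisP: EG => ->; rewrite null_gramE. Qed.

Lemma adapted_x : adapted x = E.
Proof.
apply/row_matrixP => i; rewrite rowK.
case: (indexP i) => [->|->|[i_0 i_1 di]]; rewrite ?eqxx // i_0 i_1.
by rewrite ipx di i_0 mul0r oppr0 scale0r addr0.
Qed.

Lemma section_derivable d j : derivable (fun y => k y 0 j) x (delta_mx 0 d).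
Proof. by have [_ _ ks _] := sec; exact: smooth_derivable (ks j) Vx. Qed.

Let ip_sumE v y : ip (G y) v (k y) = \sum_j (\sum_i v 0 i * G y i j) * k y 0 j.
Proof. by rewrite /ip mxE; apply: eq_bigr => j _; rewrite !mxE. Qed.

Lemma ip_section_derivable v d :
  derivable (fun y => ip (G y) v (k y)) x (delta_mx 0 d).
Proof.
under eq_fun do rewrite ip_sumE.
apply: derivable_bigsum => j; apply: derivableM; last exact: section_derivable.
apply: derivable_bigsum => i; apply: derivableM; first exact: derivable_cst.
exact: metric_mx_derivable.
Qed.

Lemma ip_section_neq0 : \forall y \near x, ip (G y) (row i1 E) (k y) != 0.
Proof.
have kc j : {for x, continuous (fun y => k y 0 j)}.
  by have [_ _ ks _] := sec; have [kc _] := ks j 0%N; exact: kc.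
have Gc i j : {for x, continuous (fun y => G y i j)}.
  rewrite (_ : (fun y => _) = fun y => tcomp g a y [tuple i; j]).
    by have [Gc _] := tcomp_smooth g a [tuple i; j] 0%N; exact: Gc.
  by apply/funext => y; rewrite mxE.
have C (Fx : set_system 'rV[R]_n) : Filter Fx ->
    (forall j, k y 0 j @[y --> Fx] --> k x 0 j) ->
    (forall i j, G y i j @[y --> Fx] --> G x i j) ->
    ip (G y) (row i1 E) (k y) @[y --> Fx] --> ip (G x) (row i1 E) (k x).
  move=> FF kF GF; under eq_fun do rewrite ip_sumE.
  rewrite ip_sumE; apply: cvg_big => [|j _]; first exact: add_continuous.
  apply: cvgM; last exact: kF.
  apply: cvg_big => [|i _]; first exact: add_continuous.
  by apply: cvgM; [exact: cvg_cst|exact: GF].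
apply: (cvgr_neq0 _ (C _ _ kc Gc)).
by rewrite ipx dual1 eqxx oner_eq0.
Qed.

Lemma adapted_derivable d i j :
  derivable (fun y => adapted y i j) x (delta_mx 0 d).
Proof.
have [i_0|i_0] := eqVneq i i0.
  rewrite (_ : (fun y => _) = fun y => k y 0 j); first exact: section_derivable.
  by apply/funext => y; rewrite !mxE i_0 eqxx.
have [i_1|i_1] := eqVneq i i1.
  rewrite (_ : (fun y => _) = cst (E i1 j)); first exact: derivable_cst.
  by apply/funext => y; rewrite !mxE i_1 mxE.
rewrite (_ : (fun y => _) = fun y => E i j -
    ip (G y) (row i E) (k y) * (ip (G y) (row i1 E) (k y))^-1 * E i1 j).
  apply: derivableB; first exact: derivable_cst.
  apply: derivableM; last exact: derivable_cst.
  apply: derivableM; first exact: ip_section_derivable.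
  apply: derivableV; last exact: ip_section_derivable.
  by rewrite ipx dual1 eqxx oner_eq0.
by apply/funext => y; rewrite !mxE (negbTE i_0) (negbTE i_1) !mxE mulNr.
Qed.

Definition near_frame y := V y /\ ip (G y) (row i1 E) (k y) != 0.

Lemma near_near_frame : \forall y \near x, near_frame y.
Proof.
apply: filter_app ip_section_neq0.
have : \forall y \near x, V y.
  by have [Vo _ _ _] := sec; apply: open_nbhs_nbhs.
by apply: filterS.
Qed.

Lemma row_adapted0 y : row i0 (adapted y) = k y.
Proof. by rewrite rowK. Qed.

Lemma adapted_orthogonal y i : near_frame y -> i != i1 ->
  ip (G y) (row i (adapted y)) (k y) = 0.
Proof.
move=> [Vy y1] i_1; rewrite rowK; have [_ Va _ ck] := sec.
case: eqP => [_|/eqP i_0].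
  by have := line_null (Va y Vy) (ck y Vy).2.
by rewrite (negbTE i_1) ipDl ipZl mulNr divfK // subrr.
Qed.

(** The matrix of [adapted] in a genuine null frame along the congruence does not
    lower boost weights. *)
Lemma adapted_weight_le r (T : components M r) b y : near_frame y ->
  boost_order_le c T b -> weight_le b (pull (T a y) (adapted y)).
Proof.
move=> hy Tb; have [Vy _] := hy; have [F FG F0] := section_null_basis Vy.
rewrite (null_basis_coord (adapted y) FG) pull_mul.
apply: pull_weight_le; last exact: boost_order_weight_le Vy FG F0 Tb.
have C i j : (adapted y *m G y *m F^T *m null_mx R m) i j =
    ip (G y) (row i (adapted y)) (row (dual j) F).
  by rewrite mul_null_mx ipE.
move=> i j; apply: contraR; rewrite -ltNge C => wij.
have [i_0|i_0] := eqVneq i i0.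
  rewrite i_0 row_adapted0 -F0; move/null_basisP: FG => ->.
  rewrite null_gramE (inj_eq (can_inj dualK)); move: wij.
  by rewrite i_0 (eq_sym i0); case: (j =P i0) => [->|_]; rewrite ?ltxx // eqxx.
have [i_1|i_1] := eqVneq i i1.
  move: wij; rewrite i_1 /weight eqxx.
  by case: eqP; case: eqP.
have [j_1|j_1] := eqVneq j i1.
  by rewrite j_1 dual1 F0 adapted_orthogonal.
by move: wij; rewrite /weight (negbTE i_0) (negbTE i_1) (negbTE j_1); case: eqP.
Qed.

Definition conn X := frame_conn g a x adapted X.

(** The numbers g(nabla_X k, e_i) for transverse e_i: rotation coefficients of the
    congruence, such as its shear and expansion when X is transverse. *)
Definition kappa X := lowering_vec (conn X).

(** Derivative of the orthogonality of k to itself and to the transverse vectors of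
    [adapted]; the metric itself is parallel. *)
Lemma conn_metric X i : i != i1 -> conn X i i1 + conn X i0 (dual i) = 0.
Proof.
move=> i_1.
have Eu : adapted x \in unitmx by rewrite adapted_x; exact: null_basis_unit EG.
have dg d beta : derivable (fun y => tcomp g a y beta) x (delta_mx 0 d).
  exact: smooth_derivable (tcomp_smooth g a beta) ax.
have g0 : \forall y \near x, pull (tcomp g a y) (adapted y) [tuple i; i0] = 0.
  apply: filterS near_near_frame => y hy.
  by rewrite pull2E -[bilin_mx _]/(G y) -ipE row_adapted0 adapted_orthogonal.
have := nabla_vanishing g X Eu dg adapted_derivable g0.
rewrite big1 => [|d _]; last first.
  by rewrite pullE big1 ?mulr0 // => beta _; rewrite nabla_metric ?mul0r.
move/eqP; rewrite eq_sym oppr_eq0 => /eqP; rewrite adapted_x /derv.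
rewrite big_ord_recl big_ord1 => D; rewrite -[RHS]D.
have gE l p : pull (tcomp g a x) E [tuple l; p] = (dual l == p)%:R.
  by rewrite pull2E -[bilin_mx _]/(G x) EG mxE null_gramE.
have u0 f : upd [tuple i; i0] ord0 f = [tuple f; i0].
  by apply: eq_from_tnth => -[[|[|]]] // ?; rewrite tnth_upd.
have u1 f : upd [tuple i; i0] (lift ord0 ord0) f = [tuple i; f].
  by apply: eq_from_tnth => -[[|[|]]] // ?; rewrite tnth_upd.
congr (_ + _).
  transitivity (\sum_f conn X i f * (dual f == i0)%:R); last first.
    by apply: eq_bigr => f _; rewrite u0 gE.
  rewrite (bigD1 i1) //= big1 => [|f f1]; first by rewrite dual1 eqxx mulr1 addr0.
  by rewrite -(inj_eq (can_inj dualK)) dualK dual0 (negbTE f1) mulr0.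
transitivity (\sum_f conn X i0 f * (dual i == f)%:R); last first.
  by apply: eq_bigr => f _; rewrite u1 gE.
rewrite (bigD1 (dual i)) //= big1 => [|f f1]; first by rewrite eqxx mulr1 addr0.
by rewrite eq_sym (negbTE f1) mulr0.
Qed.

(** Only the null rotation part of the connection lowers boost weights; hence it
    alone enters the components of the derivative just above the boost order. *)
Lemma nabla_leading r (T : components M r) b i alpha :
  (forall d beta, derivable (fun y => T a y beta) x (delta_mx 0 d)) ->
  boost_order_le c T b -> b < boost_weight alpha ->
  pull (nabla g T a x) E [tuple of i :: alpha] =
  - derv (nullrot (kappa (row i E))) (pull (T a x) E) alpha.
Proof.
move=> dT Tb wa.
have Eu : adapted x \in unitmx by rewrite adapted_x; exact: null_basis_unit EG.
have T0 : \forall y \near x, pull (T a y) (adapted y) alpha = 0.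
  by apply: filterS near_near_frame => y hy; apply: adapted_weight_le hy Tb _ wa.
have := nabla_vanishing g (row i E) Eu dT adapted_derivable T0.
rewrite adapted_x [RHS](_ : _ = - derv (nullrot (kappa (row i E))) (pull (T a x) E) alpha).
  move=> <-; rewrite /pull pull_cons; apply: eq_bigr => d _.
  by rewrite mxE.
congr (- _); apply: derv_nullrot wa.
- have /eqP := conn_metric (row i E) (i := i0) isT.
  by rewrite dual0 -mulr2n mulrn_eq0 /= => /eqP.
- move=> j j_0 j_1; have /eqP := conn_metric (row i E) j_1.
  have [jj|jj|[_ _ ->]] := indexP j; last by rewrite addr_eq0 => /eqP.
    by rewrite jj eqxx in j_0.
  by rewrite jj eqxx in j_1.
- exact: boost_order_weight_le Vx EG E0 Tb.
Qed.

(** The coefficient of nabla_X k along l vanishes as well, by [conn_metric], since k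
    is null. *)
Lemma nabla_vec_kappa0 X : (kappa X *m (kappa X)^T) 0 0 = 0 ->
  exists mu : R, nabla_vec g a x X k = mu *: k x.
Proof.
move=> kk; exists (conn X i0 i0).
have Eu : adapted x \in unitmx by rewrite adapted_x; exact: null_basis_unit EG.
have -> : nabla_vec g a x X k = row i0 (conn X *m E).
  rewrite -{1}adapted_x -nabla_vec_frame //; congr nabla_vec; apply/funext => y.
  by rewrite row_adapted0.
have kj j : kappa X 0 j = 0.
  have : \sum_j kappa X 0 j ^+ 2 = 0.
    rewrite -[RHS]kk [RHS]mxE.
    by apply: eq_bigr => l _; rewrite [_^T _ _]mxE.
  move/eqP; rewrite psumr_eq0 => [/allP /(_ j (mem_index_enum j))|l _].
    by rewrite sqrf_eq0 => /eqP.
  exact: sqr_ge0.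
rewrite row_mul mulmx_sum_row (bigD1 i0) //= big1 => [|j j_0].
  by rewrite addr0 mxE E0.
rewrite mxE; have [->|j_1] := eqVneq j i1; last first.
  by have := kj j; rewrite mxE (negbTE j_0) (negbTE j_1) /= => ->; rewrite scale0r.
have /eqP := conn_metric X (i := i0) isT.
by rewrite dual0 -mulr2n mulrn_eq0 /= => /eqP ->; rewrite scale0r.
Qed.

(** * Tensors of boost order -1 *)

Section TypeIII.
Variables (r : nat) (W : tensor_field M r).
Hypotheses (W_bo : boost_order_eq c W (-1)) (DW_bo : boost_order_le c (nabla g W) 0).

Let t := pull (tcomp W a x) E.
Let z := pull (nabla g W a x) E.
Let N i := nullrot (kappa (row i E)).
Let tr X : transverse (kappa X) := lowering_vec_transverse _.

Let tE b (T : components M r) : boost_order_le c T b -> weight_le b (pull (T a x) E).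
Proof. exact: boost_order_weight_le. Qed.

Lemma leading_part_neq0 : exists alpha, weight_part (-1) t alpha != 0.
Proof.
have [_ /(_ a x ax _ (null_basis_null_frame Vx EG E0))[alpha ta wa]] := W_bo.
by exists alpha; rewrite /weight_part wa eqxx.
Qed.

Lemma nabla_type3 i alpha : -1 < boost_weight alpha ->
  z [tuple of i :: alpha] = - derv (N i) t alpha.
Proof.
move=> wa; apply: nabla_leading W_bo.1 wa => d beta.
exact: smooth_derivable (tcomp_smooth W a beta) ax.
Qed.

(** A component of weight 0 becomes one of weight 1 of the derivative when k is put
    in front, so that the null rotation annihilates the leading part. *)
Lemma kappa_congruence : (kappa (row i0 E) *m (kappa (row i0 E))^T) 0 0 = 0.
Proof.
apply/eqP; apply: contraT => kk; have [alpha] := leading_part_neq0.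
rewrite (nullrot_inj (tr _) kk (@weight_part_homogeneous _ _ _ (-1) t)) ?eqxx // => beta.
rewrite derv_nullrot_part //; rewrite /weight_part; case: eqP => // wb.
apply/eqP; rewrite -oppr_eq0; apply/eqP; rewrite -nabla_type3 ?wb //.
apply: boost_order_weight_le Vx EG E0 DW_bo _ _.
by rewrite boost_weight_cons wb.
Qed.

(** Transverse vectors have weight 0, so that two derivatives along e_p followed by
    indices of weight 1 give a vanishing component. Applied to nabla W and then to W,
    [nabla_leading] shows it to be the null rotation applied twice to W. *)
Lemma kappa_transverse p : p != i0 -> p != i1 ->
  boost_order_le c (nabla g (nabla g W)) 0 ->
  (kappa (row p E) *m (kappa (row p E))^T) 0 0 = 0.
Proof.
move=> p0 p1 DDW; apply/eqP; apply: contraT => kk; have [alpha] := leading_part_neq0.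
have wp : weight p = 0 by rewrite /weight (negbTE p0) (negbTE p1).
rewrite (nullrot2_inj (tr _) kk (@weight_part_homogeneous _ _ _ (-1) t)) ?eqxx // => beta.
rewrite !derv_nullrot_part // {1}/weight_part; case: eqP => // wb.
have w1 : boost_weight beta = 1 by rewrite wb.
have := @nabla_leading _ (nabla g W) 0 p [tuple of p :: beta].
rewrite -/z boost_weight_cons wp add0r w1 => /(_ _ DW_bo isT) D.
have {D} : derv (N p) z [tuple of p :: beta] = 0.
  apply: oppr_inj; rewrite oppr0 -D => [|d gamma]; last exact: nabla_derivable.
  apply: boost_order_weight_le Vx EG E0 DDW _ _.
  by rewrite !boost_weight_cons wp w1.
(* In the slot of the inner derivative, the null rotation leaves components of
   nabla W with indices of weight 1 behind, which [nabla_type3] expresses by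
   components of W of weight 0. *)
rewrite derv_cons big1 ?add0r => [D|f _]; last first.
  rewrite nabla_type3 ?w1 // (nullrot_weight_le (tr _) (tE W_bo.1)) ?w1 //.
  by rewrite oppr0 mulr0.
apply: oppr_inj; rewrite oppr0 -[RHS]D /derv -sumrN; apply: eq_bigr => s _.
rewrite -sumrN; apply: eq_bigr => f _.
have [->|/(nullrot_weight (tr _)) wf] := eqVneq (N p (tnth beta s) f) 0.
  by rewrite !mul0r oppr0.
rewrite nabla_type3 ?mulrN // boost_weight_upd wf w1.
by rewrite [ltRHS](_ : _ = 0) //; ring.
Qed.

End TypeIII.

Lemma nabla_vec_mul C X : nabla_vec g a x (C *m X) k =
  \sum_(i < n) C 0 i *: nabla_vec g a x (row i X) k.
Proof.
apply/rowP => j; rewrite summxE mxE.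
under eq_bigr => d _ do rewrite mxE mulr_suml.
rewrite exchange_big; apply: eq_bigr => i _.
rewrite !mxE mulr_sumr; apply: eq_bigr => d _.
by rewrite !mxE mulrA.
Qed.

(** The vectors orthogonal to k are spanned by k and the transverse e_i. *)
Lemma nabla_vec_orthogonal X : inner g a x X (k x) = 0 ->
  (forall i, i != i1 -> exists mu : R, nabla_vec g a x (row i E) k = mu *: k x) ->
  exists mu : R, nabla_vec g a x X k = mu *: k x.
Proof.
move=> Xk Ek; rewrite (null_basis_coord X EG) nabla_vec_mul.
apply: (big_ind (fun v : 'rV[R]_n => exists mu : R, v = mu *: k x)).
- by exists 0; rewrite scale0r.
- by move=> _ _ [mu ->] [nu ->]; exists (mu + nu); rewrite scalerDl.
move=> i _; have [->|i_1] := eqVneq i i1; last first.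
  by have [mu ->] := Ek i i_1; rewrite scalerA; eexists.
exists 0; rewrite mul_null_mx dual1.
have -> : (X *m G x *m E^T) 0 i0 = inner g a x X (k x).
  rewrite /inner -E0 tr_row [LHS]mxE [RHS]mxE; apply: eq_bigr => l _.
  by rewrite [col _ _ _ _]mxE.
by rewrite Xk !scale0r.
Qed.

End AdaptedFrame.

Theorem proposition4 (R : realType) (n : nat) (n_ge3 : (3 <= n)%N)
    (M : manifold R n) (g : lorentz_metric M) (c : null_congruence g)
    (W : tensor_field M 4) (W_sym : symmetric_double_2form W)
    (W_bo : boost_order_eq c W (-1)) :
  boost_order_le c (nabla g W) 0 ->
  geodetic c /\ (boost_order_le c (nabla g (nabla g W)) 0 -> kundt c).
Proof.
case: n n_ge3 M g c W W_sym W_bo => [|[|m]] // _ M g c W _ W_bo DW.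
have geo a V k x E (sec : local_section c a V k) (Vx : V x)
    (EG : null_basis (metric_mx g a x) E) (E0 : row i0 E = k x) :
    exists mu : R, nabla_vec g a x (row i0 E) k = mu *: k x.
  by apply: (nabla_vec_kappa0 sec Vx EG E0); exact: (kappa_congruence sec Vx EG E0 W_bo).
split=> [a V k sec x Vx|DDW a V k sec x Vx X Xk].
  have [E EG E0] := section_null_basis sec Vx.
  by have := geo a V k x E sec Vx EG E0; rewrite E0.
have [E EG E0] := section_null_basis sec Vx.
apply: (nabla_vec_orthogonal EG E0 Xk) => i i_1.
have [->|i_0] := eqVneq i i0; first exact: geo sec Vx EG E0.
apply: (nabla_vec_kappa0 sec Vx EG E0).
exact: (kappa_transverse sec Vx EG E0 W_bo).
Qed.
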